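(* We have the following OPE: $$E(z)F(w)\sim(-1)^{N+1}\sum_{n=1}^{N}\frac{n!}{(z-w)^n}\sum_{m=0}^{N-n}\binom{N-m}{n}\Bigl(W_{m\,(-1)}(\partial-H_{(-1)})^{N-n-m}\mathbf{1}\Bigr)(w).$$
   Context: Let $N\ge2$. Everything is at critical level (the parameter $K$ of the paper is specialized to $0$). Let $\mathbb{V}_0$ be the complex vector space with basis $A_1,\dots,A_{N-1},Q,Y$ and symmetric bilinear form with $(Q,Q)=1$, $(Q,Y)=(Y,Q)=1$ and all other pairings of basis elements zero. Let $\mathcal{H}^0$ be the Heisenberg vertex algebra generated by $a\in\mathbb{V}_0$ with OPE $a(z)b(w)\sim(a,b)/(z-w)^2$; for $w\in\mathbb{V}_0$ let $\mathcal{H}^0_w$ be its highest weight module of highest weight $w$ with highest weight vector $e^{\int w}$. Let $\mathcal{V}^0=\bigoplus_{m\in\mathbb{Z}}\mathcal{H}^0_{mY}$, the (half-lattice) vertex algebra with $e^{m\int Y}(z)e^{n\int Y}(w)\sim0$, $a(z)e^{m\int Y}(w)\sim(a,mY)e^{m\int Y}(w)/(z-w)$, $\partial e^{m\int Y}=mY_{(-1)}e^{m\int Y}$ and $e^{m\int Y}_{(-1)}e^{n\int Y}=e^{(m+n)\int Y}$. Notation: $A(z)=\sum_nA_{(n)}z^{-n-1}$, $\partial$ is the translation operator, $\mathbf 1$ the vacuum. For $i=1,\dots,N$ let $X_i=-\sum_{j=1}^{i-1}\frac jNA_j+\sum_{j=i}^{N-1}\frac{N-j}{N}A_j$. Set $$H=-Y+Q+\sum_{j=1}^{N-1}\tfrac{N-j}{N}A_j,\quad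 E=e^{\int Y},\quad F=-\rho_N\cdots\rho_2\rho_1e^{-\int Y},$$ where $\rho_i=-\partial+H_{(-1)}-X_{i(-1)}$. For operators $\xi_1,\dots,\xi_N$ let $e_m(\xi_1,\dots,\xi_N)=\sum_{i_1>\dots>i_m}\xi_{i_1}\cdots\xi_{i_m}$, $e_0=1$. Set $W_0=\mathbf 1$, $W_1=0$, $W_m=e_m(\partial+X_{1(-1)},\dots,\partial+X_{N(-1)})\mathbf 1$ for $m=2,\dots,N$. All these elements lie in the subregular W-algebra $\mathcal{W}^{-N}(\mathfrak{sl}_N,f_{sub})$, viewed as a vertex subalgebra of $\mathcal{V}^0$. *)

(* Defs.v *)
From HB Require Import structures.
From mathcomp Require Import all_boot all_order all_algebra.
From mathcomp Require Import reals.
From mathcomp.real_closed Require Import complex.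

Set Implicit Arguments.
Unset Strict Implicit.
Unset Printing Implicit Defensive.

Import Order.TTheory GRing.Theory Num.Theory.
Local Open Scope ring_scope.

(* Generalized binomial coefficient; meaningful in characteristic 0. *)
Definition binz (K : fieldType) (m : int) (j : nat) : K :=
  (\prod_(i < j) (m%:~R - i%:R)) / j`!%:R.

(* [mode a n b] is the n-th product a_(n) b, so a(z) = \sum_n a_(n) z^(-n-1).
   The sums over j >= 0 in the Borcherds (Jacobi) identity are finite by
   [mode_trunc]; they are written as partial sums that are eventually equal. *)
Record vertexAlgebra (K : fieldType) := VertexAlgebra {
  va_sort :> lmodType K;
  vac : va_sort;
  mode : va_sort -> int -> va_sort -> va_sort;
  mode_linearl : forall n b, linear (fun a => mode a n b);
  mode_linearr : forall a n, linear (mode a n);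
  mode_trunc : forall a b,
    exists M : nat, forall n : nat, (M <= n)%N -> mode a n%:Z b = 0;
  vac_mode : forall n b, mode vac n b = if n == -1 then b else 0;
  mode_vac_ge0 : forall a (n : nat), mode a n%:Z vac = 0;
  mode_vacN1 : forall a, mode a (-1) vac = a;
  borcherds : forall a b c (l m n : int),
    exists M0 : nat, forall M : nat, (M0 <= M)%N ->
      \sum_(j < M) binz K m j *: mode (mode a (l + j%:Z) b) (m + n - j%:Z) c
      = \sum_(j < M) ((-1) ^+ j * binz K l j) *:
          (mode a (m + l - j%:Z) (mode b (n + j%:Z) c)
           - (-1) ^ l *: mode b (n + l - j%:Z) (mode a (m + j%:Z) c))
}.

Section VertexAlgebraNotions.
Variables (K : fieldType) (V : vertexAlgebra K).

Definition transl (a : V) : V := mode a (-2) (vac V).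

(* [ope a b [:: c_1; ...; c_r]] is a(z) b(w) ~ \sum_n c_n(w) / (z - w)^n, i.e.
   [a(z), b(w)] = \sum_n c_n(w) \partial_w^(n-1) delta(z - w) / (n-1)!,
   written as the equality of the coefficients of z^(-m-1) w^(-k-1). *)
Definition ope (a b : V) (c : seq V) : Prop :=
  forall (m k : int) (v : V),
    mode a m (mode b k v) - mode b k (mode a m v)
    = \sum_(j < size c) binz K m j *: mode c`_j (m + k - j%:Z) v.

(* xi 0, ..., xi (N-1) stand for \xi_1, ..., \xi_N. *)
Definition elem_op (N m : nat) (xi : 'I_N -> V -> V) (v : V) : V :=
  \sum_(t : m.-tuple 'I_N | sorted (fun i j : 'I_N => (j < i)%N) t)
     foldr xi v t.

End VertexAlgebraNotions.

Section HeisenbergSpace.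
Variables (K : fieldType) (N : nat).

(* The coordinates 0, ..., N-2 of 'rV_(N+1) are those on A_1, ..., A_{N-1};
   [vA j] is meaningful for 1 <= j <= N-1. *)
Definition vA (j : nat) : 'rV[K]_N.+1 := delta_mx 0 (inord j.-1).
Definition vQ : 'rV[K]_N.+1 := delta_mx 0 (inord N.-1).
Definition vY : 'rV[K]_N.+1 := delta_mx 0 (inord N).

Definition form (a b : 'rV[K]_N.+1) : K :=
  let q (u : 'rV[K]_N.+1) := u 0 (inord N.-1) in
  let y (u : 'rV[K]_N.+1) := u 0 (inord N) in
  q a * q b + q a * y b + y a * q b.

Definition vX (i : nat) : 'rV[K]_N.+1 :=
  - \sum_(1 <= j < i) (j%:R / N%:R) *: vA j
  + \sum_(i <= j < N) ((N - j)%:R / N%:R) *: vA j.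

Definition vH : 'rV[K]_N.+1 :=
  - vY + vQ + \sum_(1 <= j < N) ((N - j)%:R / N%:R) *: vA j.

End HeisenbergSpace.

Section HalfLattice.
Variables (K : fieldType) (N : nat).

Definition pbw_le (p q : 'I_N.+1 * nat) : bool :=
  (p.1 < q.1)%N || (p.1 == q.1) && (p.2 <= q.2)%N.

(* Index set of the PBW basis of \bigoplus_m H_{mY}: (m, s) with s sorted stands
   for \prod_{(i, n) in s} b_i_(-n-1) e^{m \int Y}, (b_i) the basis of 'rV. *)
Definition pbw_index (p : int * seq ('I_N.+1 * nat)) : bool :=
  sorted pbw_le p.2.

Definition pbw (V : vertexAlgebra K) (h : 'rV[K]_N.+1 -> V) (e : int -> V)
    (p : int * seq ('I_N.+1 * nat)) : V :=
  foldr (fun q v => mode (h (delta_mx 0 q.1)) (- (q.2.+1)%:Z) v) (e p.1) p.2.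

(* V, together with heis : a |-> a and ev : m |-> e^{m \int Y}, is the
   half-lattice vertex algebra. The last two fields say that V is the direct sum
   of the Fock (freely induced highest weight) modules generated by the ev m;
   the form being degenerate, these are not irreducible. *)
Record halfLattice (V : vertexAlgebra K) := HalfLattice {
  heis : {linear 'rV[K]_N.+1 -> V};
  ev : int -> V;
  heis_ope : forall a b, ope (heis a) (heis b) [:: 0; form a b *: vac V];
  ev0 : ev 0 = vac V;
  ev_ope : forall m n, ope (ev m) (ev n) [::];
  heis_ev_ope : forall a m,
    ope (heis a) (ev m) [:: form a (m%:~R *: vY K N) *: ev m];
  transl_ev : forall m,
    transl (ev m) = mode (heis (m%:~R *: vY K N)) (-1) (ev m);
  ev_mul : forall m n, mode (ev m) (-1) (ev n) = ev (m + n);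
  pbw_span : forall v : V,
    exists (s : seq (int * seq ('I_N.+1 * nat))) (c : _ -> K),
      all pbw_index s /\ v = \sum_(p <- s) c p *: pbw heis ev p;
  pbw_free : forall (s : seq (int * seq ('I_N.+1 * nat))) (c : _ -> K),
    uniq s -> all pbw_index s ->
    \sum_(p <- s) c p *: pbw heis ev p = 0 -> {in s, forall p, c p = 0}
}.

Variables (V : vertexAlgebra K) (L : halfLattice V).

Definition opH (v : V) : V := mode (heis L (vH K N)) (-1) v.
Definition opX (i : nat) (v : V) : V := mode (heis L (vX K N i)) (-1) v.
Definition rho (i : nat) (v : V) : V := - transl v + opH v - opX i v.

Definition genE : V := ev L 1.
(* foldl applies rho_1 first and rho_N last. *)
Definition genF : V := - foldl (fun v i => rho i v) (ev L (-1)) (iota 1 N).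

Definition genW (m : nat) : V :=
  match m with
  | 0 => vac V
  | 1 => 0
  | _ => elem_op m (fun (i : 'I_N) v => transl v + opX i.+1 v) (vac V)
  end.

Definition powDH (k : nat) : V :=
  iter k (fun v => transl v - opH v) (vac V).

End HalfLattice.

(* Main.v *)
Require Import Defs.
From HB Require Import structures.
From mathcomp Require Import all_boot all_order all_algebra.
From mathcomp Require Import reals.
From mathcomp.real_closed Require Import complex.
From mathcomp Require Import zify.
Set Implicit Arguments.
Unset Strict Implicit.
Unset Printing Implicit Defensive.

Import Order.TTheory GRing.Theory Num.Theory.
Local Open Scope ring_scope.

(** The proof is a computation of the products [E_(n) F] for [n >= 0]: by the
    commutator formula they determine the OPE ([ope_of_products]).

    Write [T_i = d + X_i - H], where [d] is the translation operator and [X_i], [H]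
    stand for their (-1)-modes, so that [rho_i = - T_i]. Since [[d, E_(n)] = - n E_(n-1)],
    [H_(0) E = E] and [X_i] is orthogonal to [Y], moving [E_(n)] through [T_i] gives
    [E_(n) T_i = T_i E_(n) + (n + 1) E_(n-1)] ([genE_DXH]). Also [E_(n) e^{-Y} = 0] for
    [n >= 0] and [E_(-1) e^{-Y} = 1], and the coefficient [n + 1] vanishes at [n = -1], so
    that no index falls below [-1]. Hence, in [E_(n) T_N ... T_1 e^{-Y}], exactly [n + 1]
    of the [N] factors must be consumed in lowering the index to [-1]. Whichever these
    are, they contribute [(n + 1)!], and the other ones form an elementary sum:
      [E_(n) F = (-1)^(N+1) (n + 1)! e_(N-n-1)(T_1, ..., T_N) 1]
    ([foldr_lowering], [genE_genF]).

    It remains to separate [H] from the [X_i] in this elementary sum. Fields with a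
    regular OPE commute, and on states [p] made from the [X_i] and [q] made from [H] the
    operator [T_i] acts by a Leibniz rule,
      [T_i (p_(-1) q) = ((d + X_i) p)_(-1) q + p_(-1) ((d - H) q)]
    ([DXH_leibniz]). The second summand does not depend on [i], so expanding
    [e_k(T_1, ..., T_N)] on [1_(-1) 1] groups the terms by the set of the [m] indices whose
    factor acts on the left; each such set extends to ['C(N - m, k - m)] sets of [k]
    indices ([elsym_leibniz]). The left factors are the [W_m] ([genWE]); for [m = 1] this uses
    that the [X_i] add up to zero. *)

(** * Elementary sums of noncommuting operators *)

Section ElementarySums.
Variable T : Type.

(** [e_m] of the operators [f i], for [i] in [s], multiplied in the order of [s].
    The recursion on the leftmost operator is what the inductive proofs need; [elsymE]
    and [elem_opE] relate it to sums over index tuples. *)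
Fixpoint elsym (V : nmodType) (f : T -> V -> V) (s : seq T) (m : nat) (v : V) :=
  match s, m with
  | _, 0 => v
  | [::], _.+1 => 0
  | i :: s', m'.+1 => f i (elsym f s' m' v) + elsym f s' m v
  end.

Lemma elsym0 (V : nmodType) (f : T -> V -> V) s v : elsym f s 0 v = v.
Proof. by case: s. Qed.

Lemma elsym_gt_size (V : nmodType) (f : T -> V -> V) s m v :
  (forall i, f i 0 = 0) -> (size s < m)%N -> elsym f s m v = 0.
Proof.
move=> f0; elim: s m => [|i s IHs] [|m] //= lt_sm.
by rewrite !IHs ?f0 ?addr0 // ltnW.
Qed.

Lemma elsym1 (V : nmodType) (f : T -> V -> V) s v :
  elsym f s 1 v = \sum_(i <- s) f i v.
Proof. by elim: s => [|i s IHs] /=; rewrite ?big_nil // big_cons IHs elsym0. Qed.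

Fixpoint ksubseqs (m : nat) (s : seq T) : seq (seq T) :=
  match s, m with
  | _, 0 => [:: [::]]
  | [::], _.+1 => [::]
  | i :: s', m'.+1 => [seq i :: t | t <- ksubseqs m' s'] ++ ksubseqs m s'
  end.

Lemma elsymE (V : zmodType) (f : T -> V -> V) s m v :
    (forall i, {morph f i : x y / x + y}) ->
  elsym f s m v = \sum_(t <- ksubseqs m s) foldr f v t.
Proof.
move=> fD; have f0 i : f i 0 = 0.
  by apply: (addrI (f i 0)); rewrite -fD !addr0.
elim: s m => [|i s IHs] [|m] /=; rewrite ?big_seq1 ?big_nil //.
by rewrite big_cat big_map /= !IHs (big_morph _ (fD i) (f0 i)).
Qed.

End ElementarySums.

Lemma mem_ksubseqs (T : eqType) m (s t : seq T) :
  (t \in ksubseqs m s) = (size t == m) && subseq t s.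
Proof.
elim: s m t => [|i s IHs] [|m] [|j t] //=; rewrite ?in_nil ?inE ?andbF //.
  by rewrite mem_cat IHs orbF; apply/mapP => -[].
rewrite mem_cat IHs /= eqSS.
have [->|ne_ji] := eqVneq j i.
  rewrite mem_map => [|x y []//]; rewrite IHs.
  have [_|//] := eqVneq; rewrite /=; apply/orb_idr.
  exact/subseq_trans/subseq_cons.
by case: mapP => [[x _ [eji _]]|_ //]; rewrite eji eqxx in ne_ji.
Qed.

Lemma ksubseqs_uniq (T : eqType) m (s : seq T) : uniq s -> uniq (ksubseqs m s).
Proof.
elim: s m => [|i s IHs] [|m] //= /andP[i_s s_uniq].
rewrite cat_uniq map_inj_uniq => [|x y []//]; rewrite !IHs //= andbT.
apply/hasPn => t; rewrite mem_ksubseqs => /andP[_ /mem_subseq ts].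
by apply/mapP => -[u _ tE]; move: i_s; rewrite ts // tE mem_head.
Qed.

(** The strictly decreasing tuples over ['I_N] are the subsequences of the list
    [N - 1, ..., 0], because a strictly sorted list is determined by its members. *)
Lemma elem_opE (K : fieldType) (V : vertexAlgebra K) N m (f : 'I_N -> V -> V) v :
    (forall i, {morph f i : x y / x + y}) ->
  elem_op m f v = elsym f (rev (enum 'I_N)) m v.
Proof.
move=> fD; rewrite elsymE // /elem_op.
pose gtI (i j : 'I_N) := (j < i)%N.
have gt_trans : transitive gtI by move=> i j k /[swap]; apply: ltn_trans.
have gt_irr : irreflexive gtI by move=> i; apply: ltnn.
have enum_gt : sorted gtI (rev (enum 'I_N)).
  rewrite rev_sorted -(sorted_map (f := @nat_of_ord N) (e' := ltn)) val_enum_ord.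
  exact: iota_ltn_sorted.
rewrite -big_filter -(big_map val xpredT (foldr f v)).
apply/perm_big/uniq_perm.
- by rewrite map_inj_uniq ?filter_uniq ?index_enum_uniq //; apply: val_inj.
- by rewrite ksubseqs_uniq // rev_uniq enum_uniq.
move=> t; rewrite mem_ksubseqs; apply/mapP/andP => [[u]|[/eqP tm t_sub]].
  rewrite mem_filter => /andP[u_gt _] ->; rewrite size_tuple eqxx; split=> //.
  rewrite (_ : val u = filter (mem u) (rev (enum 'I_N))) ?filter_subseq //.
  apply: (irr_sorted_eq gt_trans gt_irr) => //.
    exact: sorted_filter.
  by move=> i; rewrite mem_filter mem_rev mem_enum inE andbT.
move/eqP: tm => tm; exists (Tuple tm) => //.
by rewrite mem_filter mem_index_enum andbT; apply: (subseq_sorted gt_trans t_sub).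
Qed.

(** * Modes in a vertex algebra *)

Section VertexAlgebraTheory.
Variables (K : fieldType) (V : vertexAlgebra K).
Implicit Types (a b c v : V).

HB.instance Definition _ a n :=
  GRing.isLinear.Build K V V *:%R (mode a n) (mode_linearr a n).

Lemma modeDl a b n c : mode (a + b) n c = mode a n c + mode b n c.
Proof. by have := mode_linearl n c 1 a b; rewrite !scale1r. Qed.

Lemma mode0l n c : mode (0 : V) n c = 0.
Proof. by apply: (addrI (mode 0 n c)); rewrite -modeDl !addr0. Qed.

Lemma modeZl k a n c : mode (k *: a) n c = k *: mode a n c.
Proof. by have := mode_linearl n c k a 0; rewrite mode0l !addr0. Qed.

Lemma modeNr a n b : mode a n (- b) = - mode a n b.
Proof. exact: linearN. Qed.

Fact transl_linear : linear (@transl K V).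
Proof. exact: mode_linearl. Qed.
HB.instance Definition _ :=
  GRing.isLinear.Build K V V *:%R (@transl K V) transl_linear.

Lemma binz0 m : binz K m 0 = 1.
Proof. by rewrite /binz big_ord0 divr1. Qed.

Lemma binz1 m : binz K m 1 = m%:~R.
Proof. by rewrite /binz big_ord1 subr0 divr1. Qed.

Lemma binz0S j : binz K 0 j.+1 = 0.
Proof. by rewrite /binz big_ord_recl subrr !mul0r. Qed.

(** The Borcherds identity at [l = 0], where only the term [j = 0] of its right side
    has a nonzero binomial coefficient. *)
Lemma commutator_formula a b c (m n : int) :
  exists M0 : nat, forall M : nat, (M0 <= M)%N ->
    mode a m (mode b n c) - mode b n (mode a m c)
    = \sum_(j < M) binz K m j *: mode (mode a j%:Z b) (m + n - j%:Z) c.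
Proof.
have [M0 B] := borcherds a b c 0 m n; exists M0.+1 => M ltM.
have := B M (ltnW ltM); under eq_bigr do rewrite add0r.
move=> ->; case: M ltM => // M _; rewrite big_ord_recl big1 => [|j _].
  by rewrite binz0 mulr1 !scale1r !addr0.
by rewrite lift0 binz0S mulr0 scale0r.
Qed.

(** The Borcherds identity at [m = 0], where only the term [j = 0] of its left side
    has a nonzero binomial coefficient. *)
Lemma iterate_formula a b c (l n : int) :
  exists M0 : nat, forall M : nat, (M0 <= M)%N ->
    mode (mode a l b) n c
    = \sum_(j < M) ((-1) ^+ j * binz K l j) *:
        (mode a (l - j%:Z) (mode b (n + j%:Z) c)
         - (-1) ^ l *: mode b (n + l - j%:Z) (mode a j%:Z c)).
Proof.
have [M0 B] := borcherds a b c l 0 n; exists M0.+1 => M ltM.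
have := B M (ltnW ltM); under [in RHS]eq_bigr do rewrite !add0r.
move=> <-; case: M ltM => // M _; rewrite big_ord_recl big1 => [|j _].
  by rewrite binz0 scale1r !addr0 add0r.
by rewrite lift0 binz0S scale0r.
Qed.

Lemma ope_of_products a b (c : seq V) :
    (forall j : nat, mode a j%:Z b = c`_j) -> ope a b c.
Proof.
move=> abE m k v; have [M0 B] := commutator_formula a b v m k.
rewrite (B _ (leq_maxl M0 (size c))).
rewrite [RHS](big_ord_widen _ (fun j => binz K m j *: mode c`_j (m + k - j%:Z) v)
                (leq_maxr M0 (size c))).
rewrite [RHS]big_mkcond; apply: eq_bigr => j _; rewrite abE.
by case: ltnP => // le_cj; rewrite nth_default // mode0l scaler0.
Qed.

(** This is [[d, a_(n)] = - n a_(n-1)]. As [d] is itself given by a mode applied to the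
    vacuum, it follows from expanding [(a_(n) b)_(-2) 1], where all [b_(j) 1] with
    [j >= 0] vanish. *)
Lemma transl_mode a n b :
  transl (mode a n b) = mode a n (transl b) - n%:~R *: mode a (n - 1) b.
Proof.
have [M0 B] := iterate_formula a b (vac V) n (-2).
rewrite [LHS](B _ (leq_addr 2 M0)).
rewrite addn2 !big_ord_recl big1 => [|j _]; last first.
  rewrite mode_vac_ge0 linear0 scaler0 subr0.
  rewrite (_ : -2 + _ = j%:Z); last by rewrite !lift0; lia.
  by rewrite mode_vac_ge0 linear0 scaler0.
rewrite !mode_vac_ge0 ?linear0 ?scaler0 !subr0 binz0 binz1 mul1r scale1r addr0.
by rewrite !addr0 lift0 expr1 mulN1r scaleNr mode_vacN1.
Qed.

(** The OPE of [a(z) b(w)] has no singular part. *)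
Definition regular a b := forall n : nat, mode a n%:Z b = 0.

Lemma regular_commute a b m n c :
  regular a b -> mode a m (mode b n c) = mode b n (mode a m c).
Proof.
move=> ab; apply/eqP; rewrite -subr_eq0.
have [M0 B] := commutator_formula a b c m n.
rewrite (B _ (leqnn M0)).
by rewrite big1 // => j _; rewrite ab mode0l scaler0.
Qed.

Lemma regular_mode a b n c : regular a b -> regular a c -> regular a (mode b n c).
Proof. by move=> ab ac k; rewrite regular_commute // ac linear0. Qed.

Lemma regularD a b c : regular a b -> regular a c -> regular a (b + c).
Proof. by move=> ab ac n; rewrite linearD /= ab ac addr0. Qed.

Lemma regularB a b c : regular a b -> regular a c -> regular a (b - c).
Proof. by move=> ab ac n; rewrite linearB /= ab ac subr0. Qed.

Lemma regularDl a b c : regular a c -> regular b c -> regular (a + b) c.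
Proof. by move=> ac bc n; rewrite modeDl ac bc addr0. Qed.

Lemma regular_ope0 a b : ope a b [::] -> regular a b.
Proof.
move=> ab n; have := ab n%:Z (-1) (vac V).
by rewrite big_ord0 mode_vacN1 mode_vac_ge0 linear0 subr0.
Qed.

Lemma regular_transl a b : regular a b -> regular a (transl b).
Proof.
move=> ab n; apply/eqP; have /eqP := transl_mode a n%:Z b.
rewrite ab linear0 eq_sym subr_eq0 => /eqP ->.
case: n => [|n]; first by rewrite scale0r.
by rewrite -addn1 PoszD addrK ab scaler0.
Qed.

Lemma transl_modeN1l a b : mode (transl a) (-1) b = mode a (-2) b.
Proof.
have [M0 B] := iterate_formula a (vac V) b (-2) (-1).
rewrite [LHS](B _ (leqnSn M0)).
rewrite big_ord_recl big1 => [|j _]; rewrite !vac_mode.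
  by rewrite /= scaler0 binz0 mul1r scale1r subr0 addr0.
have -> : (-1 + (lift ord0 j)%:Z == -1) = false by apply/negbTE; rewrite lift0; lia.
have -> : (-1 - 2 - (lift ord0 j)%:Z == -1) = false by apply/negbTE; rewrite lift0; lia.
by rewrite linear0 !scaler0 subr0 scaler0.
Qed.

Lemma regular_transll a b : regular a b -> regular (transl a) b.
Proof.
move=> ab n; have [M0 B] := iterate_formula a (vac V) b (-2) n%:Z.
rewrite [LHS](B _ (leqnn M0)).
rewrite big1 // => j _; rewrite !vac_mode ab if_same scaler0 subr0.
by rewrite linear0 scaler0.
Qed.

Lemma transl_modeN1 a b :
  transl (mode a (-1) b) = mode (transl a) (-1) b + mode a (-1) (transl b).
Proof. by rewrite transl_mode transl_modeN1l mulrN1z scaleN1r opprK addrC. Qed.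

Lemma regular_modeN1l a b c : regular a c -> regular b c -> regular (mode a (-1) b) c.
Proof.
move=> ac bc n; have [M0 B] := iterate_formula a b c (-1) n%:Z.
rewrite [LHS](B _ (leqnn M0)).
by rewrite big1 // => j _; rewrite -PoszD bc ac !(linear0, scaler0, subr0).
Qed.

(** The (-1)-product is not associative in general. Here every term of the iterate
    formula but the leading one contains some [a_(j) c] or [b_(j) c] with [j >= 0]. *)
Lemma modeN1A a b c : regular a c -> regular b c ->
  mode (mode a (-1) b) (-1) c = mode a (-1) (mode b (-1) c).
Proof.
move=> ac bc; have [M0 B] := iterate_formula a b c (-1) (-1).
rewrite [LHS](B _ (leqnSn M0)).
rewrite big_ord_recl big1 => [|j _].
  by rewrite ac linear0 scaler0 binz0 mul1r scale1r !subr0 !addr0.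
rewrite ac linear0 scaler0 subr0 (_ : -1 + (lift ord0 j)%:Z = j%:Z).
  by rewrite bc linear0 scaler0.
by rewrite lift0; lia.
Qed.

End VertexAlgebraTheory.

(** * Commuting a lowering family past a product, and a Leibniz rule *)

Section LinearElementarySums.
Variables (K : fieldType) (V : lmodType K) (T : Type).

(** Here [G k] plays the role of the mode [E_(k-1)]. Reaching [G 0 u], the only value on
    [u] that survives, uses [k] factors for the lowering, with coefficients
    [k, k - 1, ..., 1]; the elementary sum collects the remaining [size s - k] factors. *)
Lemma foldr_lowering (f : T -> {linear V -> V}) (G : nat -> V -> V) (u : V) s k :
    (forall i y, G 0 (- f i y) = - f i (G 0 y)) ->
    (forall k i y, G k.+1 (- f i y) = - f i (G k.+1 y) - k.+1%:R *: G k y) ->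
    (forall k, G k.+1 u = 0) ->
  G k (foldr (fun i y => - f i y) u s) =
    if (k <= size s)%N then
      ((-1) ^+ size s * k`!%:R) *: elsym (fun i => f i) s (size s - k) (G 0 u)
    else 0.
Proof.
move=> G0 GS Gu; elim: s k => [|i s IHs] [|k] //=.
- by rewrite mulr1 scale1r.
- rewrite G0 IHs !subn0 linearZ /= [elsym _ s (size s).+1 _]elsym_gt_size => [|j|//].
    by rewrite addr0 exprS mulN1r mulNr scaleNr.
  exact: linear0.
rewrite GS !IHs ltnS subSS.
have [lt_ks|lt_sk|eq_ks] := ltngtP k (size s).
- rewrite -(subnSK lt_ks) /= linearZ /= scalerA scalerDr exprS mulN1r !mulNr !scaleNr.
  by rewrite factS natrM mulrCA.
- by rewrite linear0 scaler0 subr0 oppr0.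
rewrite eq_ks subnn !elsym0 linear0 oppr0 sub0r scalerA.
by rewrite exprS mulN1r mulNr scaleNr factS natrM mulrCA.
Qed.

Lemma elsym_closed (P : V -> Prop) (f : T -> V -> V) s m p :
    P 0 -> (forall x y, P x -> P y -> P (x + y)) -> (forall i x, P x -> P (f i x)) ->
  P p -> P (elsym f s m p).
Proof.
move=> P0 PD Pf Pp; elim: s m => [|i s IHs] [|m] //=.
by apply: PD => //; apply: Pf.
Qed.

(** A Leibniz rule makes [S i] act on products as [D i] on the left factor plus [B] on
    the right one. Since [B] is the same for all [i], a term of the expansion with [D] at
    [m] given indices occurs once for each choice of the [k - m] indices of [B] among the
    other [size s - m]. In the induction on [s] this is Pascal's rule. The predicates
    [P] and [Q] single out the factors on which the Leibniz rule holds. *)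
Lemma elsym_leibniz (mul : V -> V -> V) (D S : T -> {linear V -> V}) (B : V -> V)
    (P Q : V -> Prop) s k p q :
    (forall y x x', mul (x + x') y = mul x y + mul x' y) ->
    P 0 -> (forall x y, P x -> P y -> P (x + y)) -> (forall i x, P x -> P (D i x)) ->
    (forall y, Q y -> Q (B y)) ->
    (forall i x y, P x -> Q y -> S i (mul x y) = mul (D i x) y + mul x (B y)) ->
    P p -> Q q ->
  elsym (fun i => S i) s k (mul p q) =
    \sum_(m < k.+1) 'C(size s - m, k - m)%:R *:
      mul (elsym (fun i => D i) s m p) (iter (k - m) B q).
Proof.
move=> mulD P0 PD PDi QB leib Pp Qq.
have mul0 y : mul 0 y = 0 by apply: (addrI (mul 0 y)); rewrite -mulD !addr0.
have Qiter n : Q (iter n B q) by elim: n => //= n; apply: QB.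
have D0 i : D i 0 = 0 by apply: linear0.
elim: s k => [|i s IHs] k.
  case: k => [|k]; first by rewrite big_ord1 /= scale1r.
  rewrite /= big_ord_recl big1 ?addr0 => [|m _]; first by rewrite scale0r.
  by rewrite lift0 mul0 scaler0.
case: k => [|k]; first by rewrite big_ord1 /= bin0 scale1r.
rewrite /= !IHs linear_sum /=.
(* The right factors of [b m] have the exponent that is wanted for the list [i :: s]. *)
pose b m := mul (elsym (fun j => D j) s m p) (iter (k.+1 - m) B q).
have -> : \sum_(m < k.+1) S i ('C(size s - m, k - m)%:R *:
             mul (elsym (fun j => D j) s m p) (iter (k - m) B q)) =
    \sum_(m < k.+1) 'C(size s - m, k - m)%:R *:
             mul (D i (elsym (fun j => D j) s m p)) (iter (k - m) B q)
    + \sum_(m < k.+1) 'C(size s - m, k - m)%:R *: b m.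
  rewrite -big_split; apply: eq_bigr => m _ /=.
  rewrite linearZ /= leib //; last exact: elsym_closed.
  by rewrite scalerDr /b subSn // -ltnS.
rewrite [RHS](_ : _ = \sum_(m < k.+1) 'C(size s - m, k - m)%:R *:
             mul (D i (elsym (fun j => D j) s m p)) (iter (k - m) B q)
    + \sum_(m < k.+2) 'C((size s).+1 - m, k.+1 - m)%:R *: b m); last first.
  rewrite [LHS]big_ord_recl [X in _ = _ + X]big_ord_recl /= addrCA; congr (_ + _).
    by rewrite /b elsym0.
  rewrite -big_split; apply: eq_bigr => m _ /=.
  by rewrite !subSS mulD scalerDr.
rewrite -addrA; congr (_ + _).
rewrite [X in _ + X]big_ord_recr [RHS]big_ord_recr /= !subnn !bin0 addrA; congr (_ + _);
  last by rewrite /b subnn.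
rewrite -big_split; apply: eq_bigr => m _ /=; rewrite -scalerDl -natrD.
(* Pascal's rule fails for truncated differences, but then [b m = 0]. *)
have [le_ms|lt_sm] := leqP m (size s).
  by rewrite !subSn // ?binS 1?addnC // -ltnS.
by rewrite /b elsym_gt_size // mul0 !scaler0.
Qed.

End LinearElementarySums.

(** * The vectors [X_i] and [H] *)

Section HeisenbergVectors.
Variables (K : fieldType) (N : nat).

(** The coefficient of [vA j] is [- j / N] in the last [N - j] vectors and
    [(N - j) / N] in the first [j]. *)
Lemma sum_vX : \sum_(i < N) vX K N i.+1 = 0.
Proof.
pose c (i j : nat) : K := if (j < i.+1)%N then - (j%:R / N%:R) else (N - j)%:R / N%:R.
have vXE (i : 'I_N) : vX K N i.+1 = \sum_(1 <= j < N) c i j *: vA K N j.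
  rewrite (big_cat_nat _ (n := i.+1)) //= /vX -sumrN; congr (_ + _).
    by apply: eq_big_nat => j /andP[_ lt_ji]; rewrite /c lt_ji scaleNr.
  by apply: eq_big_nat => j /andP[le_ij _]; rewrite /c ltnNge le_ij.
under eq_bigr do rewrite vXE; rewrite exchange_big big_nat big1 //= => j jN.
rewrite -scaler_suml (_ : \sum_(i < N) c i j = 0) ?scale0r //.
rewrite -(big_mkord xpredT (c^~ j)) (big_cat_nat _ (n := j)) //=; last lia.
rewrite (eq_big_nat _ _ (F2 := fun=> (N - j)%:R / N%:R)); last first.
  by move=> i ij; rewrite /c ifF //; apply/negbTE; lia.
rewrite [X in _ + X](eq_big_nat _ _ (F2 := fun=> - (j%:R / N%:R))); last first.
  by move=> i ij; rewrite /c ifT //; lia.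
by rewrite !sumr_const_nat subn0 mulNrn -!mulrnAl -!mulrnA mulnC subrr.
Qed.

Hypothesis N_ge2 : (2 <= N)%N.

Lemma sum_vA_coord (c : nat -> K) a b k :
    (0 < a)%N -> (b <= N)%N -> (N.-1 <= k <= N)%N ->
  (\sum_(a <= j < b) c j *: vA K N j) 0 (inord k) = 0.
Proof.
move=> a_gt0 le_bN kN; rewrite summxE big_nat big1 // => j jab; rewrite !mxE eqxx /=.
suff -> : (inord k == inord j.-1 :> 'I_N.+1) = false by rewrite mulr0.
by apply/negbTE; rewrite -val_eqE /= !inordK; lia.
Qed.

Lemma vX_coord i k : (i <= N)%N -> (0 < i)%N -> (N.-1 <= k <= N)%N ->
  vX K N i 0 (inord k) = 0.
Proof.
by move=> le_iN i_gt0 kN; rewrite /vX mxE mxE !sum_vA_coord // oppr0 addr0.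
Qed.

Lemma form_vXl i a : (i < N)%N -> Defs.form (vX K N i.+1) a = 0.
Proof. by move=> lt_iN; rewrite /Defs.form !vX_coord ?mul0r ?addr0 //; lia. Qed.

Lemma form_vXr a i : (i < N)%N -> Defs.form a (vX K N i.+1) = 0.
Proof. by move=> lt_iN; rewrite /Defs.form !vX_coord ?mulr0 ?addr0 //; lia. Qed.

Lemma form_vHY : Defs.form (vH K N) (vY K N) = 1.
Proof.
have neq : (inord N.-1 == inord N :> 'I_N.+1) = false.
  by apply/negbTE; rewrite -val_eqE /= !inordK; lia.
have HQ : vH K N 0 (inord N.-1) = 1.
  by rewrite /vH mxE sum_vA_coord ?leqnn ?leq_pred // !mxE !eqxx neq /= oppr0 add0r addr0.
have YQ : vY K N 0 (inord N.-1) = 0 by rewrite mxE neq andbF.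
by rewrite /Defs.form HQ YQ mxE !eqxx !mulr0 add0r addr0 mulr1.
Qed.

End HeisenbergVectors.

(** * The OPE of [E] and [F] *)

Section SubregularOPE.
Variables (K : fieldType) (N : nat) (V : vertexAlgebra K) (L : halfLattice N V).
Hypothesis N_ge2 : (2 <= N)%N.

Let DX (i : 'I_N) : {linear V -> V} := @transl K V \+ mode (heis L (vX K N i.+1)) (-1).
Let DH : {linear V -> V} := @transl K V \- mode (heis L (vH K N)) (-1).
Let DXH (i : 'I_N) : {linear V -> V} := DH \+ mode (heis L (vX K N i.+1)) (-1).

Lemma ev_heis a m n y :
  mode (ev L m) n (mode (heis L a) (-1) y) =
  mode (heis L a) (-1) (mode (ev L m) n y)
    - Defs.form a (m%:~R *: vY K N) *: mode (ev L m) (n - 1) y.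
Proof.
have := heis_ev_ope L a m (-1) n y; rewrite big_ord1 /= binz0 scale1r modeZl subr0.
by rewrite [-1 + n]addrC => <-; rewrite opprB addrC subrK.
Qed.

(** The translation operator contributes [n] to the coefficient and [H] contributes 1. *)
Lemma genE_DXH i n y : mode (genE L) n (DXH i y) =
  DXH i (mode (genE L) n y) + (n + 1)%:~R *: mode (genE L) (n - 1) y.
Proof.
rewrite /genE /DXH /= [mode _ n (_ + _)]linearD /= [mode _ n (_ - _)]linearB /=.
rewrite !ev_heis !scale1r form_vXl // scale0r subr0 form_vHY //.
rewrite scale1r transl_mode intrD scalerDl scale1r.
set e := mode _ (n - 1) y; set t := n%:~R *: e; set h := mode (heis L (vH K N)) _ _.
set x := mode (heis L (vX K N i.+1)) _ _.
by rewrite opprB -!addrA (addrCA x t) (addrCA (- h) t) addKr (addrCA e) (addrC e).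
Qed.

Lemma genFE : genF L = - foldr (fun i y => - DXH i y) (ev L (-1)) (rev (enum 'I_N)).
Proof.
rewrite /genF -[N in iota 1 N](size_enum_ord N) -(foldl_rev (fun v i => - DXH i v)) revK.
have -> : iota 1 (size (enum 'I_N)) = [seq (nat_of_ord i).+1 | i <- enum 'I_N].
  by rewrite size_enum_ord (iotaDl 1 0) -val_enum_ord -map_comp.
congr (- _).
elim: (enum _) (ev L _) => //= i s IHs v; rewrite IHs; congr foldl.
by rewrite /rho /opX /opH !opprD opprK.
Qed.

Lemma genE_genF (n : nat) : mode (genE L) n%:Z (genF L) =
  if (n < N)%N then
    ((-1) ^+ N.+1 * n.+1`!%:R) *:
       elsym (fun i => DXH i) (rev (enum 'I_N)) (N - n.+1) (vac V)
  else 0.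
Proof.
have ev_vac : mode (genE L) (-1) (ev L (-1)) = vac V by rewrite ev_mul subrr ev0.
have regE : regular (genE L) (ev L (-1)) by apply: regular_ope0; apply: ev_ope.
(* The shift by one makes the lowering family end at the mode [E_(-1)]. *)
pose G (k : nat) := mode (genE L) (k%:Z - 1).
have := @foldr_lowering _ _ _ DXH G (ev L (-1)) (rev (enum 'I_N)) n.+1.
rewrite size_rev size_enum_ord /G sub0r ev_vac.
have -> : n.+1%:Z - 1 = n by lia.
rewrite genFE modeNr => ->.
- case: ifP => _; last exact: oppr0.
  by rewrite exprS mulN1r mulNr scaleNr.
- by move=> i y; rewrite modeNr genE_DXH addNr scale0r addr0.
- move=> k i y; rewrite modeNr genE_DXH opprD; congr (- _ - _ *: mode _ _ _); last lia.
  by rewrite subrK.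
by move=> k; rewrite (_ : k.+1%:Z - 1 = k) ?regE //; lia.
Qed.

Lemma genWE m : genW L m = elsym (fun i => DX i) (rev (enum 'I_N)) m (vac V).
Proof.
case: m => [|[|m]]; first by rewrite elsym0.
  rewrite elsym1 (perm_big (enum 'I_N)) /=; last exact/permPl/perm_rev.
  rewrite big_enum /= (eq_bigr (fun i : 'I_N => heis L (vX K N i.+1))) => [|i _].
    by rewrite -linear_sum /= sum_vX linear0.
  by rewrite /transl vac_mode add0r mode_vacN1.
by apply: elem_opE => i; apply: (linearD (DX i)).
Qed.

Lemma regular_heis a b : Defs.form a b = 0 -> regular (heis L a) (heis L b).
Proof.
move=> ab0 n; have := heis_ope L a b n (-1) (vac V).
rewrite mode_vacN1 mode_vac_ge0 linear0 subr0 => ->.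
by rewrite !big_ord_recl big_ord0 /= ab0 scale0r !mode0l !scaler0 !addr0.
Qed.

(** The right factors of the Leibniz rule, made from [H], satisfy [Xreg], and the left
    ones, made from the [X_i], satisfy [Wlike]. Describing them by regularity, and not by
    generators, keeps exactly what the Leibniz rule uses and what [DH] and [DX] preserve. *)
Let Xreg q := forall i : 'I_N, regular (heis L (vX K N i.+1)) q.
Let Wlike p := regular (heis L (vH K N)) p /\ forall q, Xreg q -> regular p q.

Lemma Xreg_DH q : Xreg q -> Xreg (DH q).
Proof.
move=> q_reg i; apply: regularB; first exact/regular_transl/q_reg.
by apply: regular_mode => //; apply/regular_heis/form_vXl.
Qed.

Lemma Wlike_DX i p : Wlike p -> Wlike (DX i p).
Proof.
move=> [Hp p_reg]; split=> [|q q_reg].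
  apply: regularD; first exact: regular_transl.
  by apply: regular_mode => //; apply/regular_heis/form_vXr.
apply: regularDl; first exact/regular_transll/p_reg.
by apply: regular_modeN1l; [apply: q_reg | apply: p_reg].
Qed.

(** Regularity lets [H] pass the left factor, and lets [X_i] be absorbed into it. *)
Lemma DXH_leibniz i p q : Wlike p -> Xreg q ->
  DXH i (mode p (-1) q) = mode (DX i p) (-1) q + mode p (-1) (DH q).
Proof.
move=> [Hp p_reg] q_reg; rewrite /DXH /DX /DH /= modeDl modeN1A; last exact: p_reg.
  rewrite transl_modeN1 [mode p _ (_ - _)]linearB /= (regular_commute _ _ _ Hp).
  by rewrite -!addrA; congr (_ + _); rewrite addrA addrC.
exact: q_reg.
Qed.

Lemma elsym_DXH k :
  elsym (fun i => DXH i) (rev (enum 'I_N)) k (vac V) =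
    \sum_(m < k.+1) 'C(N - m, k - m)%:R *: mode (genW L m) (-1) (powDH L (k - m)).
Proof.
have Xvac : Xreg (vac V) by move=> i n; rewrite mode_vac_ge0.
rewrite -{1}(mode_vacN1 (vac V)).
rewrite (elsym_leibniz (mul := fun p q => mode p (-1) q) (D := DX) (B := DH)
  (P := Wlike) (Q := Xreg)) //.
- by rewrite size_rev size_enum_ord; apply: eq_bigr => m _; rewrite genWE.
- by move=> y x x'; rewrite modeDl.
- by split=> [n|q _ n]; rewrite ?mode0l // linear0.
- move=> x y [Hx x_reg] [Hy y_reg]; split=> [|q q_reg]; first exact: regularD.
  by apply: regularDl; [apply: x_reg | apply: y_reg].
- exact: Wlike_DX.
- exact: Xreg_DH.
- exact: DXH_leibniz.
- by split=> [n|q _ n]; rewrite ?mode_vac_ge0 // vac_mode.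
Qed.

Lemma ope_genE_genF :
  ope (genE L) (genF L)
    [seq ((-1) ^+ N.+1 * n`!%:R) *:
         \sum_(0 <= m < (N - n).+1)
            'C(N - m, n)%:R *: mode (genW L m) (-1) (powDH L (N - n - m))
    | n <- iota 1 N].
Proof.
apply: ope_of_products => j; rewrite genE_genF.
case: ltnP => [lt_jN|le_Nj]; last by rewrite nth_default // size_map size_iota.
rewrite (nth_map 0%N) ?size_iota // nth_iota // add1n elsym_DXH big_mkord.
congr (_ *: _); apply: eq_bigr => m _; congr (_%:R *: _).
have le_mN := ltn_ord m; rewrite -subnDA addnC subnDA bin_sub //; lia.
Qed.

End SubregularOPE.

(* MathComp; the complex numbers are R[i] for R : realType. *)
Theorem theorem4p4 (R : realType) (N : nat) (hN : (2 <= N)%N)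
    (V : vertexAlgebra R[i]) (L : halfLattice N V) :
  ope (genE L) (genF L)
    [seq ((-1) ^+ N.+1 * n`!%:R) *:
         \sum_(0 <= m < (N - n).+1)
            'C(N - m, n)%:R *: mode (genW L m) (-1) (powDH L (N - n - m))
    | n <- iota 1 N].
Proof. exact: ope_genE_genF. Qed.
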